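(* Let $(a_k)_{k\in\mathbb Z}$ be a nonnegative sequence in $\ell^2(\mathbb Z)$ and let $A=[a_{i-j}]_{i,j\in\mathbb N_0}$. Then \[\frac1{\sqrt2}\|(a_k)\|_2\le\mathfrak s(\mathcal S(A))\le\|(a_k)\|_2.\]
   Context: For a nonnegative matrix $A$, $\mathcal S(A)$ is the set of matrices $S=[s_{ij}]$ with $|s_{ij}|\le a_{ij}$ for all $i,j$, and $\mathfrak s(\mathcal S(A))=\sup_{S\in\mathcal S(A)}\|S\|_m$, where $\|S\|_m$ is the norm of the Schur multiplier $T=[t_{ij}]\mapsto[s_{ij}t_{ij}]$ on $\mathcal B(\ell^2(\mathbb N_0))$. *)

(* Defs.v *)
From HB Require Import structures.
From mathcomp Require Import all_boot all_order all_algebra.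
From mathcomp Require Import complex.
From mathcomp Require Import boolp classical_sets reals constructive_ereal ereal.
Set Implicit Arguments. Unset Strict Implicit. Unset Printing Implicit Defensive.
Import Order.TTheory GRing.Theory Num.Theory.
Local Open Scope ring_scope.
Local Open Scope classical_set_scope.

Definition cabs (R : realType) (z : R[i]) : R := ComplexField.Normc.normc z.

(* Operator norm on B(l^2(N_0)) (complex scalars) of the infinite matrix T,
   as the supremum over finite sections:
   sup { |sum_{i,j<n} y_i T_ij x_j| : n, sum_{j<n}|x_j|^2 <= 1, sum_{i<n}|y_i|^2 <= 1 }.
   This equals ||T|| when T is (the matrix of) a bounded operator on
   l^2(N_0), and +oo otherwise. *)
Definition opnorm (R : realType) (T : nat -> nat -> R[i]) : \bar R :=
  ereal_sup [set e : \bar R | exists (n : nat) (x y : nat -> R[i]),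
     \sum_(j < n) cabs (x j) ^+ 2 <= 1 /\
     \sum_(i < n) cabs (y i) ^+ 2 <= 1 /\
     e = (cabs (\sum_(i < n) \sum_(j < n) y i * T i j * x j))%:E].

Definition bounded_mx (R : realType) (T : nat -> nat -> R[i]) : Prop :=
  (opnorm T < +oo)%E.

Definition schur_norm (R : realType) (S : nat -> nat -> R[i]) : \bar R :=
  ereal_sup [set opnorm (fun i j => S i j * T i j) |
             T in [set T | bounded_mx T /\ (opnorm T <= 1)%E]].

Definition SA (R : realType) (A : nat -> nat -> R) : set (nat -> nat -> R[i]) :=
  [set S | forall i j, cabs (S i j) <= A i j].

Definition frak_s (R : realType) (A : nat -> nat -> R) : \bar R :=
  ereal_sup [set schur_norm S | S in SA A].

(* squared l^2(Z) norm of a : int -> R, as sup of symmetric partial sums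
   sum_{-n <= k < n} a_k^2  (Negz i = -(i+1)) *)
Definition l2sq (R : realType) (a : int -> R) : \bar R :=
  ereal_sup [set (\sum_(i < n) (a (Posz i) ^+ 2 + a (Negz i) ^+ 2))%:E
            | n in [set: nat]].

Definition in_l2 (R : realType) (a : int -> R) : Prop := (l2sq a < +oo)%E.

Definition l2norm (R : realType) (a : int -> R) : R := Num.sqrt (fine (l2sq a)).

Definition toeplitz (R : realType) (a : int -> R) : nat -> nat -> R :=
  fun i j => a (Posz i - Posz j)%R.

(* Main.v *)
Require Import Defs.
From HB Require Import structures.
From mathcomp Require Import all_boot all_order all_algebra.
From mathcomp Require Import complex.
From mathcomp Require Import boolp classical_sets reals constructive_ereal ereal.
From mathcomp Require Import ring lra zify.
Import Order.TTheory GRing.Theory Num.Theory.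
Local Open Scope ring_scope.
Set Implicit Arguments. Unset Strict Implicit. Unset Printing Implicit Defensive.

(** Upper bound: the rows of a contraction [T] have norm at most 1, so the
    Cauchy-Schwarz inequality applied to [sum (x_j s_ij) (y_i t_ij)] over pairs
    [(i, j)] bounds the Schur multiplier norm of [S] by the largest column norm.

    Lower bound: choosing the signs of [S] freely, [frak_s A] is at least
    [n^-1 sum_(i, j < n) a_ij |w_ij|] for every real contraction [W].  Let [T]
    be the [n x n] section of [A] with random signs and [N] the squared norm of
    [a].  Then [tr (T^T T)] is the sum of the squared entries of the section,
    about [n N], while the expectation of [tr ((T^T T)^2)] is at most about
    [2 n N^2]; by Hoelder's inequality the normalized trace norm of [T] is
    asymptotically at least [sqrt (N / 2)] for some choice of signs.  An
    explicit contraction [W], a rational function of [T], realizes this bound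
    without singular values. *)

(** * Gram matrices, rational contractions and random signs over a real field *)

Section RealMatrices.
Variable R : realFieldType.
Implicit Types n : nat.

Definition sqnorm n (v : 'cV[R]_n) : R := \sum_i v i 0 ^+ 2.

Lemma sqnormE n (v : 'cV[R]_n) : sqnorm v = (v^T *m v) 0 0.
Proof. by rewrite mxE; apply: eq_bigr => i _; rewrite mxE expr2. Qed.

Lemma sqnorm_ge0 n (v : 'cV[R]_n) : 0 <= sqnorm v.
Proof. by apply: sumr_ge0 => i _; apply: sqr_ge0. Qed.

Lemma sqnorm_eq0 n (v : 'cV[R]_n) : sqnorm v = 0 -> v = 0.
Proof.
move=> /psumr_eq0P v0; apply/colP => i; rewrite mxE.
by apply/eqP; rewrite -sqrf_eq0 v0// => j _; apply: sqr_ge0.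
Qed.

Lemma mxtrace_gram m n (X : 'M[R]_(m, n)) :
  \tr (X^T *m X) = \sum_i \sum_j X i j ^+ 2.
Proof.
rewrite exchange_big; apply: eq_bigr => j _.
by rewrite mxE; apply: eq_bigr => i _; rewrite mxE expr2.
Qed.

Lemma mxtrace_gram_ge0 m n (X : 'M[R]_(m, n)) : 0 <= \tr (X^T *m X).
Proof.
rewrite mxtrace_gram; apply: sumr_ge0 => i _; apply: sumr_ge0 => j _.
exact: sqr_ge0.
Qed.

Lemma sqnorm_add_gram m n (B : 'M[R]_(m, n)) (w : 'cV[R]_n) :
  sqnorm (w + B^T *m B *m w) =
  sqnorm w + 2 * sqnorm (B *m w) + sqnorm (B^T *m B *m w).
Proof.
rewrite !sqnormE [(_ + _)^T]linearD /= mulmxDl !mulmxDr !trmx_mul trmxK !mulmxA.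
by rewrite !mxE; ring.
Qed.

Lemma sqnorm_sub_gram m n (B : 'M[R]_(m, n)) (w : 'cV[R]_n) :
  sqnorm (w - B^T *m B *m w) =
  sqnorm w - 2 * sqnorm (B *m w) + sqnorm (B^T *m B *m w).
Proof.
rewrite !sqnormE [(_ - _)^T]linearB /= mulmxBl !mulmxBr !trmx_mul trmxK !mulmxA.
by rewrite !mxE; ring.
Qed.

(** For a vector [v] killed by this matrix, the expansion of [sqnorm_add_gram] writes 0 as a sum of
    nonnegative terms, one of which is the squared norm of [v]. *)
Lemma add1_gram_unitmx m n (B : 'M[R]_(m, n)) : 1%:M + B^T *m B \in unitmx.
Proof.
rewrite -unitmx_tr -row_free_unit; apply: inj_row_free => v Pv0.
have /(congr1 (@sqnorm n)) : v^T + B^T *m B *m v^T = 0.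
  rewrite -[LHS]trmxK linearD /= trmxK [_^T in X in _ + X]trmx_mul trmxK.
  by rewrite -{1}[v]mulmx1 -mulmxDr -[1%:M]trmx1 -linearD /= Pv0 trmx0.
have sq0 : sqnorm (0 : 'cV[R]_n) = 0.
  by rewrite /sqnorm big1// => i _; rewrite mxE expr0n.
rewrite sqnorm_add_gram sq0 => v0; apply: trmx_inj; rewrite trmx0.
apply: sqnorm_eq0.
have := sqnorm_ge0 v^T; have := sqnorm_ge0 (B *m v^T).
by have := sqnorm_ge0 (B^T *m B *m v^T); lra.
Qed.

(* The witness is [f(B)] for the odd function [f(s) = 2s / (1 + s^2)] in the
   sense of singular values: [f <= 1], and [f(s) s] lies above the tangent
   parabola in [s^2] at [s = 1]. *)
Lemma contraction_tangent m n (B : 'M[R]_(m, n)) :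
  exists W : 'M[R]_(m, n),
    (forall v, sqnorm (W *m v) <= sqnorm v) /\
    3 / 2 * \tr (B^T *m B) - 1 / 2 * \tr ((B^T *m B)^T *m (B^T *m B))
      <= \tr (W^T *m B).
Proof.
set P := B^T *m B; set M := invmx (1%:M + P).
have unitP := add1_gram_unitmx B.
have PT : P^T = P by rewrite /P trmx_mul trmxK.
have MT : M^T = M by rewrite /M trmx_inv linearD /= PT trmx1.
have M1P : M *m (1%:M + P) = 1%:M by rewrite mulVmx.
have MP : M *m P = 1%:M - M by rewrite -M1P mulmxDr mulmx1 addrC addKr.
have PM : P *m M = 1%:M - M by rewrite -[LHS]trmxK trmx_mul MT PT MP linearB /= trmx1 MT.
exists (2 *: (B *m M)); split.
  move=> v; set w := M *m v.
  have -> : v = w + P *m w.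
    by rewrite -[X in X + _]mul1mx -mulmxDl /w mulmxA mulmxV ?mul1mx.
  have -> : 2 *: (B *m M) *m (w + P *m w) = 2 *: (B *m w).
    rewrite -scalemxAl -(mulmxA B); congr (_ *: (_ *m _)).
    by rewrite -[X in X + _]mul1mx -mulmxDl mulmxA M1P mul1mx.
  have -> : sqnorm (2 *: (B *m w)) = 4 * sqnorm (B *m w).
    by rewrite /sqnorm mulr_sumr; apply: eq_bigr => i _; rewrite mxE; ring.
  (* With [v = w + P w] and [W v = 2 B w], the loss [|v|^2 - |W v|^2] is exactly [|w - P w|^2]. *)
  have := sqnorm_ge0 (w - P *m w).
  by rewrite sqnorm_sub_gram sqnorm_add_gram; lra.
have -> : \tr ((2 *: (B *m M))^T *m B) = 2 * \tr (M *m P).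
  by rewrite linearZ /= trmx_mul MT -scalemxAl mxtraceZ -mulmxA.
(* In terms of a singular value s, the gap [2s^2/(1+s^2) - (3/2)s^2 + (1/2)s^4] equals
   [s^2 (1-s^2)^2 / (2(1+s^2))]. The trace of [Y^T M Y] is twice the sum of these gaps. *)
set Y := (1%:M - P) *m B^T.
have YMY : Y^T *m M *m Y = B *m (4 *: M - 3 *: 1%:M + P) *m B^T.
  rewrite /Y trmx_mul trmxK linearB /= trmx1 PT -!mulmxA; congr (_ *m _).
  rewrite !mulmxA; congr (_ *m _).
  rewrite mulmxBl mul1mx PM mulmxBr mulmx1 !mulmxBl mul1mx MP.
  by apply/matrixP => i j; rewrite !mxE; ring.
have trYMY : \tr (Y^T *m M *m Y) =
    4 * \tr (M *m P) - 3 * \tr P + \tr (P^T *m P).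
  rewrite YMY -mulmxA mxtrace_mulC -mulmxA -/P !mulmxDl mulNmx -!scalemxAl mul1mx PT.
  by rewrite !mxtraceD raddfN /= !mxtraceZ.
(* Expanding [M = M (1 + P) M] shows that [M] is positive semidefinite without diagonalizing it. *)
have Mgram : M = M^T *m M + (B *m M)^T *m (B *m M).
  rewrite trmx_mul MT -!mulmxA (mulmxA B^T) -/P -mulmxDr.
  by rewrite -[X in X + _]mul1mx -mulmxDl mulmxV // mulmx1.
have : 0 <= \tr (Y^T *m M *m Y).
  rewrite Mgram mulmxDr mulmxDl mxtraceD addr_ge0//.
    by have := mxtrace_gram_ge0 (M *m Y); rewrite trmx_mul !mulmxA.
  by have := mxtrace_gram_ge0 (B *m M *m Y); rewrite trmx_mul !mulmxA.
by rewrite trYMY; lra.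
Qed.

(** Flipping the sign at [i0] is an involution of the index set that negates every term, so the sum
    equals its own opposite. *)
Lemma big_bool_flip (I : finType) (i0 : I) (f : {ffun I -> bool} -> R) :
  (forall e : {ffun I -> bool}, f [ffun i => (i == i0) (+) e i] = - f e) -> \sum_e f e = 0.
Proof.
move=> fN; set flip := fun e : {ffun I -> bool} => [ffun i => (i == i0) (+) e i].
have flipK : involutive flip.
  by move=> e; apply/ffunP => i; rewrite !ffunE addKb.
have : \sum_e f e = - \sum_e f e.
  rewrite {1}(reindex_inj (inv_inj flipK)) -sumrN.
  by apply: eq_bigr => e _; apply: fN.
lra.
Qed.

Lemma exists_le0_of_sum0 (I : finType) (i0 : I) (f : I -> R) :
  \sum_i f i = 0 -> exists i, f i <= 0.
Proof.
move=> f0; apply: contrapT => /forallNP fpos.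
suff : 0 < \sum_i f i by rewrite f0 ltxx.
rewrite (bigD1 i0)//= ltr_pwDl//; first by rewrite ltNge; apply/negP.
by apply: sumr_ge0 => i _; apply: ltW; rewrite ltNge; apply/negP.
Qed.

(* In the expansion of [\tr ((T^T T)^2)] as a sum over pairs of rows and pairs
   of columns, the terms in which both pairs are proper are products of four
   distinct signs, so they average to zero. *)
Lemma signs_gram_sqr m n (A : 'M[R]_(m, n)) :
  exists T : 'M[R]_(m, n), (forall i j, `|T i j| = `|A i j|) /\
    \tr ((T^T *m T)^T *m (T^T *m T)) <=
      \sum_i (\sum_j A i j ^+ 2) ^+ 2 + \sum_j (\sum_i A i j ^+ 2) ^+ 2.
Proof.
pose T (e : {ffun 'I_m * 'I_n -> bool}) : 'M[R]_(m, n) :=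
  \matrix_(i, j) ((-1) ^+ e (i, j) * A i j).
pose c (e : {ffun 'I_m * 'I_n -> bool}) i i' j j' : R :=
  T e i j * T e i' j * (T e i j' * T e i' j').
pose off e := \sum_i \sum_i' \sum_j \sum_j'
  (if (i != i') && (j != j') then c e i i' j j' else 0).
have [e off_le0] : exists e, off e <= 0.
  apply: (exists_le0_of_sum0 [ffun=> false]).
  rewrite exchange_big big1// => i _; rewrite exchange_big big1// => i' _.
  rewrite exchange_big big1// => j _; rewrite exchange_big big1// => j' _.
  have [/andP[ii' jj']|_] := boolP ((i != i') && (j != j')); last by rewrite big1.
  (* As [i != i'] and [j != j'], the sign at [(i, j)] enters only the first of the four factors of
     [c]. *)
  apply: (@big_bool_flip _ (i, j)) => e; rewrite /c !mxE !ffunE !xpair_eqE !eqxx.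
  rewrite (eq_sym i') (eq_sym j') (negbTE ii') (negbTE jj') /=.
  by rewrite signrN; ring.
have TA i j : T e i j ^+ 2 = A i j ^+ 2 by rewrite mxE exprMn sqrr_sign mul1r.
exists (T e); split=> [i j|]; first by rewrite mxE normrM normr_sign mul1r.
have -> : \tr (((T e)^T *m T e)^T *m ((T e)^T *m T e)) =
    \sum_i \sum_i' \sum_j \sum_j' c e i i' j j'.
  rewrite mxtrace_gram.
  transitivity (\sum_j \sum_j' \sum_i \sum_i' c e i i' j j').
    apply: eq_bigr => j _; apply: eq_bigr => j' _; rewrite mxE expr2 mulr_suml.
    apply: eq_bigr => i _; rewrite mulr_sumr; apply: eq_bigr => i' _.
    by rewrite /c !(mxE trmx_key); ring.
  under eq_bigr => j _ do rewrite exchange_big.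
  rewrite exchange_big; apply: eq_bigr => i _.
  under eq_bigr => j _ do rewrite exchange_big.
  by rewrite exchange_big.
have -> : \sum_i (\sum_j A i j ^+ 2) ^+ 2 =
    \sum_i \sum_i' \sum_j \sum_j' (if i == i' then A i j ^+ 2 * A i j' ^+ 2 else 0).
  apply: eq_bigr => i _; rewrite (bigD1 i)//= [X in _ + X]big1 ?addr0; last first.
    by move=> i' /negbTE i'i; rewrite big1// => j _; rewrite big1// => j' _; rewrite eq_sym i'i.
  rewrite eqxx expr2 mulr_suml; apply: eq_bigr => j _.
  by rewrite mulr_sumr.
have -> : \sum_j (\sum_i A i j ^+ 2) ^+ 2 =
    \sum_i \sum_i' \sum_j \sum_j' (if j == j' then A i j ^+ 2 * A i' j ^+ 2 else 0).
  transitivity (\sum_j \sum_i \sum_i' A i j ^+ 2 * A i' j ^+ 2).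
    apply: eq_bigr => j _; rewrite expr2 mulr_suml; apply: eq_bigr => i _.
    by rewrite mulr_sumr.
  rewrite exchange_big; apply: eq_bigr => i _; rewrite exchange_big.
  apply: eq_bigr => i' _; apply: eq_bigr => j _.
  rewrite (bigD1 j)//= eqxx big1 ?addr0// => j' /negbTE j'j.
  by rewrite eq_sym j'j.
(* Adding [off e], which is at most 0, to the right-hand side lets the comparison be made term by
   term. Quadruples with [i = i'] and [j = j'] are counted in both sums, whence an inequality. *)
rewrite -[leRHS]addr0; apply: le_trans (lerD (lexx _) off_le0).
rewrite /off -!big_split; apply: ler_sum => i _; rewrite -!big_split.
apply: ler_sum => i' _; rewrite -!big_split; apply: ler_sum => j _.
rewrite -!big_split; apply: ler_sum => j' _ /=.
have sqM_ge0 (x y : R) : 0 <= x ^+ 2 * y ^+ 2 by rewrite mulr_ge0 ?sqr_ge0.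
have [<-|ii'] /= := eqVneq i i'.
  rewrite addr0 /c -!expr2 !TA lerDl; case: ifP => // _; exact: sqM_ge0.
have [<-|jj'] /= := eqVneq j j'; last by rewrite !add0r.
by rewrite add0r addr0 /c -expr2 exprMn !TA.
Qed.
End RealMatrices.

(** Lagrange's identity: the double sum of [(f i * g j - f j * g i) ^+ 2] is twice the difference of
    the two sides. *)
Lemma CauchySchwarz_sum (R : realFieldType) (I : finType) (f g : I -> R) :
  (\sum_i f i * g i) ^+ 2 <= (\sum_i f i ^+ 2) * (\sum_i g i ^+ 2).
Proof.
have : 0 <= \sum_i \sum_j (f i * g j - f j * g i) ^+ 2.
  by apply: sumr_ge0 => i _; apply: sumr_ge0 => j _; apply: sqr_ge0.
have -> : \sum_i \sum_j (f i * g j - f j * g i) ^+ 2 =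
    \sum_i \sum_j f i ^+ 2 * g j ^+ 2 + \sum_i \sum_j f j ^+ 2 * g i ^+ 2
    - 2 * \sum_i \sum_j (f i * g i) * (f j * g j).
  rewrite mulr_sumr -sumrN -!big_split; apply: eq_bigr => i _ /=.
  rewrite mulr_sumr -sumrN -!big_split; apply: eq_bigr => j _ /=; ring.
rewrite [X in _ + X - _]exchange_big /=.
have sumM (u v : I -> R) : \sum_i \sum_j u i * v j = (\sum_i u i) * \sum_j v j.
  by rewrite mulr_suml; apply: eq_bigr => i _; rewrite mulr_sumr.
rewrite !sumM -expr2; lra.
Qed.

(** * The modulus of complex numbers *)

Section ComplexModulus.
Variable R : realType.
Implicit Types z : R[i].
Local Open Scope complex_scope.

Lemma cabs_ge0 z : 0 <= cabs z.
Proof. by case: z => u v; apply: sqrtr_ge0. Qed.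

Lemma sqr_cabs z : cabs z ^+ 2 = complex.Re z ^+ 2 + complex.Im z ^+ 2.
Proof. by case: z => u v; rewrite /cabs /= sqr_sqrtr// addr_ge0 ?sqr_ge0. Qed.

Lemma cabsM z1 z2 : cabs (z1 * z2) = cabs z1 * cabs z2.
Proof. exact: ComplexField.Normc.normcM. Qed.

Lemma cabs0 : cabs (0 : R[i]) = 0.
Proof. exact: ComplexField.Normc.normc0. Qed.

Lemma cabs_real (r : R) : cabs r%:C = `|r|.
Proof. by rewrite /cabs /= expr0n /= addr0 sqrtr_sqr. Qed.

Lemma cabs_conj z : cabs z^* = cabs z.
Proof. by case: z => u v; rewrite /cabs /= sqrrN. Qed.

Lemma mul_conj_cabs z : z * z^* = (cabs z ^+ 2)%:C.
Proof.
rewrite sqr_cabs; case: z => u v; apply/eqP; rewrite eq_complex /=.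
by apply/andP; split; apply/eqP; ring.
Qed.

Lemma cabs_sum (I : finType) (f : I -> R[i]) :
  cabs (\sum_i f i) <= \sum_i cabs (f i).
Proof.
apply: (big_rec2 (fun z r => cabs z <= r)); first by rewrite cabs0.
by move=> i r z _ zr; apply: le_trans (le_normcD _ _) _; rewrite lerD2l.
Qed.

Lemma cabs_sum_sqr (I : finType) (f g : I -> R[i]) :
  cabs (\sum_i f i * g i) ^+ 2 <=
  (\sum_i cabs (f i) ^+ 2) * (\sum_i cabs (g i) ^+ 2).
Proof.
apply: le_trans (CauchySchwarz_sum _ _).
rewrite ler_sqr ?nnegrE ?cabs_ge0//; last first.
  by apply: sumr_ge0 => i _; rewrite mulr_ge0 ?cabs_ge0.
by apply: le_trans (cabs_sum _) _; under eq_bigr do rewrite cabsM.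
Qed.

End ComplexModulus.

(** * Upper bound by the column norms *)

Section UpperBound.
Variable R : realType.
Implicit Types S T : nat -> nat -> R[i].
Local Open Scope complex_scope.

Lemma opnorm_le1 T : (opnorm T <= 1)%E -> forall n (x y : nat -> R[i]),
  \sum_(j < n) cabs (x j) ^+ 2 <= 1 -> \sum_(i < n) cabs (y i) ^+ 2 <= 1 ->
  cabs (\sum_(i < n) \sum_(j < n) y i * T i j * x j) <= 1.
Proof.
move=> T1 n x y x1 y1; rewrite -lee_fin; apply: le_trans T1.
by apply: ereal_sup_ubound; exists n, x, y.
Qed.

(** Test [T] on the [i]-th basis vector and the normalized conjugate of the row: the form then takes
    the norm of the row as its value. *)
Lemma contraction_row_le1 T n (i : 'I_n) : (opnorm T <= 1)%E ->
  \sum_(j < n) cabs (T i j) ^+ 2 <= 1.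
Proof.
move=> T1; set r := \sum_(j < n) _.
have r0 : 0 <= r by apply: sumr_ge0 => j _; apply: sqr_ge0.
have [->|rN0] := eqVneq r 0; first exact: ler01.
pose s := Num.sqrt r.
have s2 : s ^+ 2 = r by rewrite sqr_sqrtr.
have s0 : 0 < s by rewrite sqrtr_gt0 lt_neqAle eq_sym rN0.
pose x j := s^-1%:C * (T i j)^*; pose y k : R[i] := (k == i :> nat)%:R.
have /(_ n x y) := opnorm_le1 T1.
have -> : \sum_(i0 < n) \sum_(j < n) y i0 * T i0 j * x j = s%:C.
  rewrite (bigD1 i)//= [X in _ + X]big1 ?addr0; last first.
    move=> k ki; rewrite big1// => j _.
    by rewrite /y (_ : (k == i :> nat) = false) ?mul0r//; exact/negbTE.
  transitivity (\sum_(j < n) (s^-1 * cabs (T i j) ^+ 2)%:C).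
    by apply: eq_bigr => j _; rewrite /y eqxx mul1r /x mulrCA mul_conj_cabs [RHS]rmorphM.
  by rewrite -rmorph_sum -mulr_sumr -/r -s2 expr2 mulKf ?gt_eqF.
rewrite cabs_real (ger0_norm (ltW s0)) => sle1.
rewrite -s2 -[leRHS](expr1n _ 2) ler_sqr ?nnegrE ?(ltW s0)//; apply: sle1.
  have -> : \sum_(j < n) cabs (x j) ^+ 2 = s^-1 ^+ 2 * r.
    rewrite mulr_sumr; apply: eq_bigr => j _.
    by rewrite /x cabsM exprMn cabs_conj cabs_real real_normK ?num_real.
  by rewrite -s2 -exprMn mulVf ?gt_eqF// expr1n.
rewrite (bigD1 i)//= [X in _ + X]big1 ?addr0; last first.
  move=> k ki; rewrite /y (_ : (k == i :> nat) = false) ?cabs0 ?expr0n//.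
  exact/negbTE.
by rewrite /y eqxx -[1%:R]/(1%:C) cabs_real normr1 expr1n.
Qed.

Lemma schur_norm_le_col S (c : R) : 0 <= c ->
  (forall n (j : 'I_n), \sum_(i < n) cabs (S i j) ^+ 2 <= c) ->
  (schur_norm S <= (Num.sqrt c)%:E)%E.
Proof.
move=> c0 colS; apply: ge_ereal_sup => _ [T [_ T1] <-].
apply: ge_ereal_sup => _ [n [x [y [x1 [y1 ->]]]]]; rewrite lee_fin.
rewrite -(ger0_norm (cabs_ge0 _)) -sqrtr_sqr ler_sqrt// pair_bigA /=.
(* Grouping [x] with [S] and [y] with [T] leaves, after Cauchy-Schwarz, column sums of [S] and row
   sums of [T]. *)
rewrite (eq_bigr (fun p : 'I_n * 'I_n =>
  (x p.2 * S p.1 p.2) * (y p.1 * T p.1 p.2))); last by move=> p _; ring.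
apply: le_trans (cabs_sum_sqr _ _) _.
rewrite -(pair_bigA _ (fun i j : 'I_n => cabs (x j * S i j) ^+ 2)) /=.
rewrite -(pair_bigA _ (fun i j : 'I_n => cabs (y i * T i j) ^+ 2)) /=.
rewrite -[leRHS]mulr1; apply: ler_pM.
- by apply: sumr_ge0 => i _; apply: sumr_ge0 => j _; apply: sqr_ge0.
- by apply: sumr_ge0 => i _; apply: sumr_ge0 => j _; apply: sqr_ge0.
- rewrite exchange_big /=.
  apply: le_trans (_ : \sum_(j < n) cabs (x j) ^+ 2 * c <= _).
    apply: ler_sum => j _; under eq_bigr do rewrite cabsM exprMn.
    by rewrite -mulr_sumr ler_wpM2l ?sqr_ge0 ?colS.
  by rewrite -mulr_suml -[leRHS]mul1r ler_wpM2r.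
- apply: le_trans y1; apply: ler_sum => i _.
  under eq_bigr do rewrite cabsM exprMn.
  by rewrite -mulr_sumr -[leRHS]mulr1 ler_wpM2l ?sqr_ge0 ?contraction_row_le1.
Qed.

Lemma frak_s_le_col (A : nat -> nat -> R) (c : R) : 0 <= c ->
  (forall n (j : 'I_n), \sum_(i < n) A i j ^+ 2 <= c) ->
  (frak_s A <= (Num.sqrt c)%:E)%E.
Proof.
move=> c0 colA; apply: ge_ereal_sup => _ [S SA <-].
apply: schur_norm_le_col => // n j; apply: le_trans (colA n j).
apply: ler_sum => i _; have SAij := SA i j.
by rewrite ler_sqr ?nnegrE ?cabs_ge0// (le_trans _ SAij) ?cabs_ge0.
Qed.

End UpperBound.

(** * Pairing a nonnegative matrix with a contraction *)

Lemma sqr_eq_norm (R : realDomainType) (x y : R) : `|x| = `|y| -> x ^+ 2 = y ^+ 2.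
Proof. by move=> xy; rewrite -[LHS]real_normK ?num_real// xy real_normK ?num_real. Qed.

(** The signed matrix [T] is scaled before [contraction_tangent] is applied; signs do not matter in
    the end, since the pairing of [W] with [T] is at most that of [|W|] with [A]. *)
Lemma contraction_pairing (R : rcfType) m n (A : 'M[R]_(m, n)) (c : R) :
  0 < c -> (forall i j, 0 <= A i j) ->
  (forall i, \sum_j A i j ^+ 2 <= c) -> (forall j, \sum_i A i j ^+ 2 <= c) ->
  exists W : 'M[R]_(m, n), (forall v, sqnorm (W *m v) <= sqnorm v) /\
    (\sum_i \sum_j A i j ^+ 2) / Num.sqrt (2 * c) <=
      \sum_i \sum_j A i j * `|W i j|.
Proof.
move=> c0 A0 rowA colA; set q := \sum_i _.
have [T [absT trT]] := signs_gram_sqr A.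
(* At this scale the fourth-order trace of [t *: T] is at most its second-order trace [t ^+ 2 * q],
   so the tangent bound is at least [(3/2 - 1/2) * t ^+ 2 * q]. *)
pose t := (Num.sqrt (2 * c))^-1.
have t0 : 0 < t by rewrite invr_gt0 sqrtr_gt0 mulr_gt0.
have t2 : t ^+ 2 * (2 * c) = 1.
  by rewrite exprVn sqr_sqrtr ?mulVf ?mulf_neq0 ?gt_eqF// mulr_ge0 ?ltW.
have [W [Wcontr trW]] := contraction_tangent (t *: T).
exists W; split=> //.
have gramT : (t *: T)^T *m (t *: T) = t ^+ 2 *: (T^T *m T).
  by rewrite [(_ *: _)^T]linearZ /= -scalemxAl -scalemxAr scalerA.
have trTT : \tr (T^T *m T) = q.
  rewrite mxtrace_gram; apply: eq_bigr => i _; apply: eq_bigr => j _.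
  exact: sqr_eq_norm.
(* Rows and columns contribute [c * q] each; this factor 2 is the source of the constant
   [1 / sqrt 2]. *)
have trT4 : \tr ((T^T *m T)^T *m (T^T *m T)) <= 2 * c * q.
  have sum_sqr (I : finType) (f : I -> R) : (forall i, 0 <= f i <= c) ->
      \sum_i f i ^+ 2 <= c * \sum_i f i.
    move=> fc; rewrite mulr_sumr; apply: ler_sum => i _; have /andP[? ?] := fc i.
    by rewrite expr2 ler_wpM2r.
  apply: le_trans trT _.
  have := sum_sqr _ (fun i => \sum_j A i j ^+ 2).
  have := sum_sqr _ (fun j => \sum_i A i j ^+ 2).
  rewrite exchange_big /= -/q => colc rowc.
  suff: \sum_j (\sum_i A i j ^+ 2) ^+ 2 <= c * q /\
        \sum_i (\sum_j A i j ^+ 2) ^+ 2 <= c * q by lra.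
  by split; [apply: colc => j|apply: rowc => i]; apply/andP; split=> //;
    apply: sumr_ge0 => k _; apply: sqr_ge0.
have trWT : \tr (W^T *m (t *: T)) <= t * \sum_i \sum_j A i j * `|W i j|.
  rewrite -scalemxAr mxtraceZ ler_pM2l// /mxtrace.
  under eq_bigr => j _ do rewrite mxE.
  rewrite exchange_big; apply: ler_sum => i _; apply: ler_sum => j _.
  by rewrite mxE -[A i j]ger0_norm// -absT mulrC -normrM ler_norm.
rewrite gramT [(_ *: _)^T]linearZ /= -scalemxAl -scalemxAr !mxtraceZ trTT in trW.
rewrite -/t -(ler_pM2l t0); apply: le_trans trWT; apply: le_trans trW.
have : t ^+ 2 * (t ^+ 2 * \tr ((T^T *m T)^T *m (T^T *m T))) <= t ^+ 2 * q.
  rewrite ler_pM2l ?exprn_gt0// -[leRHS]mul1r -t2 -(mulrA (t ^+ 2)).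
  by rewrite ler_pM2l ?exprn_gt0.
rewrite (_ : t * (q * t) = t ^+ 2 * q); last by ring.
lra.
Qed.

(** * Row and column sums of Toeplitz sections *)

Section Toeplitz.
Variables (R : realType) (f : int -> R).

Lemma toeplitz_row_sum n (i : 'I_n) :
  \sum_(j < n) f (Posz i - Posz j) =
  \sum_(k < i.+1) f (Posz k) + \sum_(k < n - i.+1) f (Negz k).
Proof.
transitivity (\sum_(0 <= j < n) f (Posz i - Posz j)); first by rewrite big_mkord.
(* The diagonal entry has index 0 and belongs to the nonnegative indices, hence the cut after
   [j = i]; the column sum is cut before [i = j] for the same reason. *)
rewrite (@big_cat_nat _ _ _ i.+1)//= big_mkord; congr (_ + _).
  rewrite (reindex_inj rev_ord_inj); apply: eq_bigr => k _ /=.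
  by rewrite subSS; congr f; have := ltn_ord k; lia.
rewrite -{1}(add0n i.+1) big_addn big_mkord; apply: eq_bigr => k _.
by congr f; lia.
Qed.

Lemma toeplitz_col_sum n (j : 'I_n) :
  \sum_(i < n) f (Posz i - Posz j) =
  \sum_(k < n - j) f (Posz k) + \sum_(k < j) f (Negz k).
Proof.
transitivity (\sum_(0 <= i < n) f (Posz i - Posz j)); first by rewrite big_mkord.
rewrite (@big_cat_nat _ _ _ j) ?(ltnW (ltn_ord j))//= big_mkord addrC; congr (_ + _).
  rewrite -{1}(add0n j) big_addn big_mkord; apply: eq_bigr => k _.
  by congr f; lia.
rewrite (reindex_inj rev_ord_inj); apply: eq_bigr => k _ /=.
by congr f; have := ltn_ord k; lia.
Qed.

End Toeplitz.

Lemma ler_sum_ord (R : numDomainType) (f : nat -> R) m n :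
  (forall i, 0 <= f i) -> (m <= n)%N -> \sum_(i < m) f i <= \sum_(i < n) f i.
Proof.
move=> f0 mn; rewrite (big_ord_widen n f mn) big_mkcond; apply: ler_sum => i _.
by case: ifP.
Qed.

Section SquareSums.
Variables (R : realType) (a : int -> R).
Hypothesis a_l2 : in_l2 a.

Let psum m := \sum_(k < m) (a (Posz k) ^+ 2 + a (Negz k) ^+ 2).

Lemma l2sq_fin : l2sq a = (fine (l2sq a))%:E.
Proof.
rewrite fineK// fin_numElt a_l2 andbT; apply: lt_le_trans (ltNyr 0) _.
by apply: ereal_sup_ubound; exists 0%N => //; rewrite big_ord0.
Qed.

Lemma psum_le_l2sq m : psum m <= fine (l2sq a).
Proof. by rewrite -lee_fin -l2sq_fin; apply: ereal_sup_ubound; exists m. Qed.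

Lemma l2sq_le (c : R) : (forall m, psum m <= c) -> fine (l2sq a) <= c.
Proof.
move=> psumc; rewrite -lee_fin -l2sq_fin; apply: ge_ereal_sup => _ [m _ <-].
by rewrite lee_fin psumc.
Qed.

Let le_psum p q m : (p <= m)%N -> (q <= m)%N ->
  \sum_(k < p) a (Posz k) ^+ 2 + \sum_(k < q) a (Negz k) ^+ 2 <= psum m.
Proof.
move=> pm qm; rewrite /psum big_split.
by apply: lerD; apply: (@ler_sum_ord _ (fun k => a _ ^+ 2)) => // i; apply: sqr_ge0.
Qed.

Lemma toeplitz_row_le n (i : 'I_n) :
  \sum_(j < n) toeplitz a i j ^+ 2 <= fine (l2sq a).
Proof.
rewrite (toeplitz_row_sum (fun k => a k ^+ 2)).
by apply: le_trans (psum_le_l2sq n); apply: le_psum; rewrite ?leq_subr.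
Qed.

Lemma toeplitz_col_le n (j : 'I_n) :
  \sum_(i < n) toeplitz a i j ^+ 2 <= fine (l2sq a).
Proof.
rewrite (toeplitz_col_sum (fun k => a k ^+ 2)).
apply: le_trans (psum_le_l2sq n); apply: le_psum; first exact: leq_subr.
exact: ltnW.
Qed.

(** Each of the [k] middle rows has at least [m] columns on either side of its diagonal entry, so it
    contains all indices from [-m] to [m - 1]. The first and last [m] rows are discarded. *)
Lemma toeplitz_sum_ge m k :
  k%:R * psum m <= \sum_(i < m + (k + m)) \sum_(j < m + (k + m)) toeplitz a i j ^+ 2.
Proof.
set n := (m + (k + m))%N.
rewrite big_split_ord /= [X in _ + X]big_split_ord /=.
have row0 (i : 'I_n) : 0 <= \sum_(j < n) toeplitz a i j ^+ 2.
  by apply: sumr_ge0 => j _; apply: sqr_ge0.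
rewrite -[leLHS]add0r -[_ * _]addr0; apply: lerD; last apply: lerD.
- by apply: sumr_ge0 => i _; apply: (row0 (lshift _ i)).
- have -> : k%:R * psum m = \sum_(i < k) psum m.
    by rewrite sumr_const card_ord mulr_natl.
  apply: ler_sum => i _.
  rewrite (toeplitz_row_sum (fun k => a k ^+ 2) (rshift m (lshift m i))) /=.
  rewrite /psum big_split; have := ltn_ord i.
  by move=> ik; apply: lerD; apply: (@ler_sum_ord _ (fun k => a _ ^+ 2));
    rewrite /n; try lia; move=> ?; apply: sqr_ge0.
- by apply: sumr_ge0 => i _; apply: (row0 (rshift m (rshift k i))).
Qed.

End SquareSums.

(** This fits test vectors of any length [n] to a matrix supported on the first [m] indices, with no
    order assumed between [m] and [n]. *)
Lemma sum_ord_trunc (V : nmodType) (F : nat -> V) m n :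
  (forall i, (m <= i)%N -> F i = 0) ->
  \sum_(i < n) F i = \sum_(i < m) (if (i < n)%N then F i else 0).
Proof.
move=> F0; rewrite (big_ord_widen (m + n) F (leq_addl m n)) [LHS]big_mkcond.
rewrite [RHS](big_ord_widen (m + n) (fun i => if (i < n)%N then F i else 0)
  (leq_addr n m)) [RHS]big_mkcond; apply: eq_bigr => i _ /=.
by case: (ltnP i m) => // /F0 ->; case: ifP.
Qed.

Lemma sum_ord_trunc_le (R : numDomainType) (f : nat -> R) m n :
  (forall i, 0 <= f i) ->
  \sum_(i < m) (if (i < n)%N then f i else 0) <= \sum_(i < n) f i.
Proof.
move=> f0; rewrite -big_mkcond /=.
apply: le_trans (_ : \sum_(i < m + n | (i < n)%N) f i <= _).
  rewrite (big_ord_widen_cond (m + n) (fun i => i < n)%N f) ?leq_addr//.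
  rewrite big_mkcond [leRHS]big_mkcond; apply: ler_sum => i _ /=.
  by case: (i < n)%N => //=; case: ifP.
by rewrite -(big_ord_widen (m + n) f) ?leq_addl.
Qed.

(** * Lower bound by finite contractions *)

Section LowerBound.
Variable R : realType.
Local Open Scope complex_scope.

Definition extend_mx n (W : 'M[R]_n) (i j : nat) : R[i] :=
  if (insub i : option 'I_n, insub j : option 'I_n) is (Some i', Some j')
  then (W i' j')%:C else 0.

Lemma extend_mxE n (W : 'M[R]_n) (i j : 'I_n) : extend_mx W i j = (W i j)%:C.
Proof. by rewrite /extend_mx !valK. Qed.

Lemma extend_mx_outl n (W : 'M[R]_n) i j : (n <= i)%N -> extend_mx W i j = 0.
Proof. by move=> ni; rewrite /extend_mx insubF// ltnNge ni. Qed.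

Lemma extend_mx_outr n (W : 'M[R]_n) i j : (n <= j)%N -> extend_mx W i j = 0.
Proof.
move=> nj; rewrite /extend_mx [insub j]insubF ?ltnNge ?nj//.
by case: insub.
Qed.

(** A real matrix acts separately on real and imaginary parts, so a real contraction is a complex
    one. *)
Lemma sum_cabs_mulmx n (W : 'M[R]_n) (x : 'I_n -> R[i]) :
  (forall v, sqnorm (W *m v) <= sqnorm v) ->
  \sum_i cabs (\sum_j (W i j)%:C * x j) ^+ 2 <= \sum_j cabs (x j) ^+ 2.
Proof.
move=> Wcontr.
pose u : 'cV[R]_n := \col_j complex.Re (x j).
pose v : 'cV[R]_n := \col_j complex.Im (x j).
have -> : \sum_j cabs (x j) ^+ 2 = sqnorm u + sqnorm v.
  by rewrite -big_split; apply: eq_bigr => j _; rewrite sqr_cabs !mxE.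
apply: le_trans (lerD (Wcontr u) (Wcontr v)).
rewrite -big_split; apply: ler_sum => i _ /=; rewrite sqr_cabs !mxE.
rewrite !raddf_sum /=.
rewrite (eq_bigr (fun j => W i j * u j 0)); last first.
  by move=> j _; rewrite mxE; case: (x j) => p q /=; ring.
rewrite [X in _ + X ^+ 2](eq_bigr (fun j => W i j * v j 0))//.
by move=> j _; rewrite mxE; case: (x j) => p q /=; ring.
Qed.

Lemma opnorm_extend_mx n (W : 'M[R]_n) :
  (forall v, sqnorm (W *m v) <= sqnorm v) -> (opnorm (extend_mx W) <= 1)%E.
Proof.
move=> Wcontr; apply: ge_ereal_sup => _ [p [x [y [x1 [y1 ->]]]]]; rewrite lee_fin.
pose trunc (z : nat -> R[i]) i := if (i < p)%N then z i else 0.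
have trunc_le1 (z : nat -> R[i]) : \sum_(i < p) cabs (z i) ^+ 2 <= 1 ->
    \sum_(i < n) cabs (trunc z i) ^+ 2 <= 1.
  apply: le_trans; apply: le_trans (@sum_ord_trunc_le _ (fun i => cabs (z i) ^+ 2) n p _) => [|i]; last exact: sqr_ge0.
  by apply: ler_sum => i _; rewrite /trunc; case: ifP; rewrite ?cabs0 ?expr0n.
rewrite (@sum_ord_trunc _ (fun i => \sum_(j < p) y i * extend_mx W i j * x j) n); last first.
  by move=> i ni; rewrite big1// => j _; rewrite extend_mx_outl// mulr0 mul0r.
rewrite (eq_bigr (fun i : 'I_n => trunc y i *
    \sum_(j < n) (W i j)%:C * trunc x j)); last first.
  move=> i _; rewrite /trunc; case: ifP => _; last by rewrite mul0r.
  rewrite (@sum_ord_trunc _ (fun j => y i * extend_mx W i j * x j) n); last first.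
    by move=> j nj; rewrite extend_mx_outr// mulr0 mul0r.
  rewrite mulr_sumr; apply: eq_bigr => j _; rewrite extend_mxE.
  by case: ifP => _; rewrite ?mulrA// !mulr0.
rewrite -(ler_sqr (cabs_ge0 _) ler01) expr1n; apply: le_trans (cabs_sum_sqr _ _) _.
rewrite -[leRHS]mulr1; apply: ler_pM.
- by apply: sumr_ge0 => i _; apply: sqr_ge0.
- by apply: sumr_ge0 => i _; apply: sqr_ge0.
- exact: trunc_le1.
- by apply: le_trans (sum_cabs_mulmx (fun j : 'I_n => trunc x j) Wcontr) (trunc_le1 _ x1).
Qed.

(** Giving [S] the signs of [W] makes every entry of the Schur product [A i j * |W i j|]. The
    constant unit vector with entries [1 / sqrt n], used on both sides, then yields the mean [n^-1]
    times the sum. *)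
Lemma frak_s_ge_pairing (A : nat -> nat -> R) n (W : 'M[R]_n) :
  (forall i j, 0 <= A i j) -> (0 < n)%N ->
  (forall v, sqnorm (W *m v) <= sqnorm v) ->
  ((n%:R^-1 * \sum_(i < n) \sum_(j < n) A i j * `|W i j|)%:E <= frak_s A)%E.
Proof.
move=> A0 n0 Wcontr; set p := \sum_(i < n) _.
pose T := extend_mx W.
have T1 : (opnorm T <= 1)%E by apply: opnorm_extend_mx.
pose S i j : R[i] := (A i j * (-1) ^+ (complex.Re (T i j) < 0)%R)%:C.
have SAS : SA A S.
  by move=> i j; rewrite cabs_real normrM normr_sign mulr1 ger0_norm.
apply: le_trans (_ : opnorm (fun i j => (S i j * T i j)%R) <= _)%E; last first.
  apply: le_trans (_ : schur_norm S <= _)%E.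
    apply: ereal_sup_ubound; exists T => //; split=> //.
    by apply: le_lt_trans T1 _; rewrite ltry.
  by apply: ereal_sup_ubound; exists S.
pose s := Num.sqrt (n%:R : R).
have s2 : s ^+ 2 = n%:R by rewrite sqr_sqrtr.
have nN0 : n%:R != 0 :> R by rewrite pnatr_eq0 -lt0n.
have flat1 : \sum_(i < n) cabs (s^-1%:C) ^+ 2 <= 1 :> R.
  rewrite sumr_const card_ord cabs_real real_normK ?num_real// exprVn s2.
  by rewrite -[_ *+ _]mulr_natl divff.
apply: ereal_sup_ubound; exists n, (fun=> s^-1%:C), (fun=> s^-1%:C); do 2 split=> //.
congr (_%:E).
have p0 : 0 <= p.
  by apply: sumr_ge0 => i _; apply: sumr_ge0 => j _; rewrite mulr_ge0.
rewrite (_ : \sum_(i < n) _ = (n%:R^-1 * p)%:C).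
  by rewrite cabs_real ger0_norm// mulr_ge0 ?invr_ge0.
rewrite /p mulr_sumr rmorph_sum; apply: eq_bigr => i _.
rewrite mulr_sumr rmorph_sum; apply: eq_bigr => j _ /=.
rewrite /S /T extend_mxE /= -!rmorphM /= -s2; congr (_%:C).
rewrite normrEsign -exprVn; ring.
Qed.

End LowerBound.

(** Dividing by [k] and letting it grow removes a boundary term [b] independent of [k]. *)
Lemma archi_le (R : archiRealFieldType) (x y b : R) :
  (forall k, k%:R * x <= k%:R * y + b) -> x <= y.
Proof.
move=> kxy; rewrite leNgt; apply/negP => yx.
have := archi_boundP (normr_ge0 (b / (x - y))).
set k := Num.bound _ => bk.
have xy0 : 0 < x - y by rewrite subr_gt0.
have := le_lt_trans (ler_norm _) bk; rewrite ltr_pdivrMr// mulrBr.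
by have := kxy k; lra.
Qed.

Theorem theorem3p4 (R : realType) (a : int -> R)
  (a_ge0 : forall k, 0 <= a k) (a_l2 : in_l2 a) :
  ((l2norm a / Num.sqrt 2)%:E <= frak_s (toeplitz a))%E /\
  (frak_s (toeplitz a) <= (l2norm a)%:E)%E.
Proof.
set c := fine (l2sq a).
have c_ge0 : 0 <= c by have := psum_le_l2sq a_l2 0; rewrite big_ord0.
have up : (frak_s (toeplitz a) <= (l2norm a)%:E)%E.
  by apply: frak_s_le_col => // n j; apply: toeplitz_col_le.
split=> //.
have A_ge0 i j : 0 <= toeplitz a i j by apply: a_ge0.
(* The 1 by 1 identity is a sufficient test. Together with [up], this makes [frak_s] finite, so that
   [fine] loses nothing below. *)
have fs_ge0 : (0 <= frak_s (toeplitz a))%E.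
  apply: le_trans (frak_s_ge_pairing (W := 1%:M) A_ge0 (ltn0Sn 0) _); last first.
    by move=> v; rewrite mul1mx.
  rewrite lee_fin mulr_ge0 ?invr_ge0//.
  by apply: sumr_ge0 => i _; apply: sumr_ge0 => j _; rewrite mulr_ge0.
have [c0|cN0] := eqVneq c 0; first by rewrite /l2norm -/c c0 sqrtr0 mul0r.
have c_gt0 : 0 < c by rewrite lt_neqAle eq_sym cN0.
have fs_fin : frak_s (toeplitz a) = (fine (frak_s (toeplitz a)))%:E.
  by rewrite fineK// ge0_fin_numE// (le_lt_trans up) ?ltry.
rewrite fs_fin lee_fin; set F := fine _ in fs_fin *.
have F_ge0 : 0 <= F by rewrite -lee_fin -fs_fin.
have d_gt0 : 0 < Num.sqrt (2 * c) by rewrite sqrtr_gt0 mulr_gt0.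
have lo n : (0 < n)%N ->
    \sum_(i < n) \sum_(j < n) toeplitz a i j ^+ 2 <= n%:R * (F * Num.sqrt (2 * c)).
  move=> n0; pose A : 'M[R]_n := \matrix_(i, j) toeplitz a i j.
  have [|||W [Wcontr]] := @contraction_pairing R n n A c c_gt0.
  - by move=> i j; rewrite mxE.
  - by move=> i; under eq_bigr do rewrite mxE; apply: toeplitz_row_le.
  - by move=> j; under eq_bigr do rewrite mxE; apply: toeplitz_col_le.
  have := frak_s_ge_pairing A_ge0 n0 Wcontr.
  rewrite fs_fin lee_fin ler_pdivrMl ?ltr0n// => pF.
  under eq_bigr do under eq_bigr do rewrite mxE.
  under [X in _ <= X -> _]eq_bigr do under eq_bigr do rewrite mxE.
  by rewrite ler_pdivrMr// => qp; apply: le_trans qp _; rewrite mulrA ler_pM2r.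
have : c <= F * Num.sqrt (2 * c).
  (* Sections of size [k + 2m] contain [k] full windows, and the [2m] extra rows cost a fixed amount
     as [k] grows. The case [k = 0] is apart because [lo] needs a nonempty section. *)
  apply: l2sq_le => // m; apply: (@archi_le _ _ _ (2 * m%:R * (F * Num.sqrt (2 * c)))).
  case=> [|k]; first by rewrite !mul0r add0r !mulr_ge0 ?(ltW d_gt0).
  apply: le_trans (toeplitz_sum_ge a m k.+1) _; apply: le_trans (lo _ _) _.
    by rewrite addSn addnS.
  by rewrite !natrD; lra.
(* Divide [c <= F * sqrt 2 * sqrt c] by [sqrt c]. *)
rewrite /l2norm -/c -{1}(sqr_sqrtr c_ge0) sqrtrM// ler_pdivrMr ?sqrtr_gt0//.
by rewrite expr2 mulrA ler_pM2r ?sqrtr_gt0.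
Qed.
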